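(* Let $V$ be a complex vector space of finite dimension $n\ge 1$, and let $I, I'\subset V\oplus V^*$ be two isotropic subspaces. Then: (1) $\dim(\hat{L}_{I}) = 2^{\,n-\dim(I)}$. (2) $\hat{L}_{I} = \hat{L}_{I'}$ if and only if $I=I'$. (3) $\hat{L}_{I} + \hat{L}_{I'} \subset \hat{L}_{I\cap I'}$. (4) If $I + I'$ is isotropic then $\hat{L}_{I+I'} = \hat{L}_{I} \cap\hat{L}_{I'}$. (5) If $u\in V \oplus V^*$ is such that $u\cdot \hat{\varphi}=0$ for all $\hat{\varphi} \in \hat{L}_{I}$, then $u\in I$. (6) $I'\subset I$ if and only if $\hat{L}_{I} \subset \hat{L}_{I'}$. (7) If $I\neq\{0\}$ then $(\hat{\varphi},\hat{\psi})=0$ for all $\hat{\varphi},\hat{\psi} \in \hat{L}_{I}$. (8) $I+I'$ is isotropic if and only if $\hat{L}_{I} \cap\hat{L}_{I'}\neq \{0\}$. (9) If $I$ is not maximal (i.e. $\dim(I)\neq n$) then $\hat{L}_{I} = \hat{L}^+_{I} \oplus \hat{L}^-_{I}$, where $\hat{L}^{+}_{I}\subset S^+$ and $\hat{L}^{-}_{I}\subset S^-$ are subspaces spanned by Weyl spinors of positive and negative chirality respectively, and $\dim(\hat{L}^+_{I})=\dim(\hat{L}^-_{I})$.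
   Context: The space $V\oplus V^*$ carries the non-degenerate symmetric bilinear form $\langle e+\theta, e'+\theta'\rangle = \frac{1}{2}[\theta(e')+\theta'(e)]$ for $e,e'\in V$, $\theta,\theta'\in V^*$. A subspace $I\subset V\oplus V^*$ is isotropic if $\langle v,v\rangle=0$ for all $v\in I$; the maximal dimension of an isotropic subspace is $n$, and $I$ is called maximal if $\dim(I)=n$. The space of spinors is $S=\wedge V^*$ (the exterior algebra, of dimension $2^n$), on which $V\oplus V^*$ acts by the Clifford action $(e+\theta)\cdot\hat{\varphi} = e\lrcorner\hat{\varphi}+\theta\wedge\hat{\varphi}$ (interior product plus exterior product); it satisfies $v\cdot(v\cdot\hat\varphi)=\langle v,v\rangle\hat\varphi$. For an isotropic subspace $I$, define $\hat{L}_{I} = \{\hat{\varphi}\in S : v\cdot\hat{\varphi}=0 \ \forall\, v\in I\}$. Fix a basis $\{e_1,\dots,e_n\}$ of $V$ with dual basis $\{\theta^1,\dots,\theta^n\}$. The inner product on $S$ is the bilinear form $(\cdot,\cdot):S\times S\to\mathbb{C}$ defined by: $(\hat{\varphi},\hat{\psi})=\lambda$ where the degree-$n$ component of $\hat{\varphi}^{\,t}\wedge\hat{\psi}$ equals $\lambda\,\theta^1\wedge\cdots\wedge\theta^n$. Here $\hat{\varphi}^{\,t}$ is the reverse of $\hat\varphi$: the linear map reversing the order of the factors in wedge products of elements of $V^*$. $S^+$ (Weyl spinors of positive chirality) is the subspace of $S$ of forms of even degree, and $S^-$ (Weyl spinors of negative chirality) is the subspace of forms of odd degree; $S=S^+\oplus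 S^-$. *)

(* Defs.v *)
From HB Require Import structures.
From mathcomp Require Import all_boot all_order all_algebra ring.
From mathcomp Require Export reals complex.

Set Implicit Arguments.
Unset Strict Implicit.
Unset Printing Implicit Defensive.

Import GRing.Theory.
Local Open Scope ring_scope.

Definition covector (F : fieldType) (V : vectType F) := 'Hom(V, F^o).

(* The exterior algebra of V^*, written in the basis of monomials
   theta^A = theta^{i_1} /\ ... /\ theta^{i_k} for A = {i_1 < ... < i_k};
   the form phi has the coefficient phi A on theta^A.  The product is wedge:
   see wedgeA, wedge1m, wedgem1, form_of_covector_sqr and monomial_prod. *)
Definition spinor (F : fieldType) (n : nat) := {ffun {set 'I_n} -> F^o}.

Section ExteriorAlgebra.

Variables (F : fieldType) (n : nat).
Implicit Types (i : 'I_n) (A B C D : {set 'I_n}) (phi psi chi : spinor F n).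

Definition monomial A : spinor F n := [ffun B => (B == A)%:R].

(* theta^A /\ theta^B = wsign A B *: theta^(A :|: B) for disjoint A and B:
   one factor -1 for each pair that has to be swapped. *)
Definition wsign A B : F := \prod_(i in A) \prod_(j in B) (-1) ^+ (j < i)%N.

Definition wedge phi psi : spinor F n :=
  [ffun A : {set 'I_n} => \sum_(B : {set 'I_n} | B \subset A)
             wsign B (A :\: B) * (phi B * psi (A :\: B))].

(* Each monomial is sent to the product of its factors in reverse order. *)
Definition reverse phi : spinor F n :=
  \sum_(A : {set 'I_n}) phi A *:
    \big[wedge/monomial set0]_(i <- rev (enum A)) monomial [set i].

(* The coefficient of theta^1 /\ ... /\ theta^n in reverse phi /\ psi. *)
Definition spinor_form phi psi : F := wedge (reverse phi) psi [set: 'I_n].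

Definition weyl_pos : {vspace spinor F n} :=
  <<[seq monomial A | A in [set A : {set 'I_n} | ~~ odd #|A|]]>>%VS.
Definition weyl_neg : {vspace spinor F n} :=
  <<[seq monomial A | A in [set A : {set 'I_n} | odd #|A|]]>>%VS.

Lemma monomialE A B : monomial A B = (B == A)%:R.
Proof. by rewrite ffunE. Qed.

Lemma spinor_monomialE phi : phi = \sum_A phi A *: monomial A.
Proof.
apply/ffunP=> B; rewrite sum_ffunE (bigD1 B) //= !ffunE eqxx.
rewrite big1 ?addr0; first by rewrite -[LHS]mulr1.
by move=> A; rewrite !ffunE eq_sym => /negPf->; rewrite scaler0.
Qed.

Lemma wedge_is_linear phi : linear (wedge phi).
Proof.
move=> a psi chi; apply/ffunP=> A; rewrite !ffunE scaler_sumr -big_split /=.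
apply: eq_bigr => B _; rewrite !ffunE !mulrDr; congr (_ + _).
by rewrite -[a *: _]/(a * _) -[X in X = _]/(_ * (_ * (a * _))) [_ * (a * _)]mulrCA [LHS]mulrCA.
Qed.

HB.instance Definition _ phi := GRing.isLinear.Build F (spinor F n) (spinor F n)
  *:%R (wedge phi) (wedge_is_linear phi).

Definition wedgel psi := wedge^~ psi.

Lemma wedgel_is_linear psi : linear (wedgel psi).
Proof.
move=> a phi chi; apply/ffunP=> A; rewrite !ffunE scaler_sumr -big_split /=.
apply: eq_bigr => B _; rewrite !ffunE mulrDl mulrDr; congr (_ + _).
by rewrite -[a *: _]/(a * _) -[X in X = _]/(_ * ((a * _) * _)) -[(a * _) * _]mulrA [LHS]mulrCA.
Qed.

HB.instance Definition _ psi := GRing.isLinear.Build F (spinor F n) (spinor F n)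
  *:%R (wedgel psi) (wedgel_is_linear psi).

Lemma wedge_monomial A B : wedge (monomial A) (monomial B) =
  if [disjoint A & B] then wsign A B *: monomial (A :|: B) else 0.
Proof.
apply/ffunP=> D; rewrite ffunE.
have [dAB|dAB] := boolP [disjoint A & B].
  have DAB : (A :|: B) :\: A = B.
    by rewrite setDUl setDv set0U; apply/setDidPl; rewrite disjoint_sym.
  rewrite !ffunE -[RHS]/(_ * _); have [->|neq] := eqVneq D (A :|: B).
    rewrite (bigD1 A) ?subsetUl //= big1 ?addr0.
      by rewrite DAB !ffunE !eqxx !mulr1.
    by move=> C /andP[_ /negPf nCA]; rewrite !ffunE nCA mul0r mulr0.
  rewrite mulr0 big1 // => C sCD; rewrite !ffunE.
  case: eqP => [CA|]; last by rewrite mul0r mulr0.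
  case: eqP => [DCB|]; last by rewrite !mulr0.
  by case/eqP: neq; rewrite -DCB -CA setDE setUIr setUCr setIT; apply/esym/setUidPr.
rewrite ffunE big1 // => C sCD; rewrite !ffunE.
case: eqP => [CA|]; last by rewrite mul0r mulr0.
case: eqP => [DCB|]; last by rewrite !mulr0.
case/negP: dAB; rewrite -DCB CA -setI_eq0; apply/eqP/setP => x.
by rewrite !inE; case: (x \in A).
Qed.

Lemma wsignUl A B C : [disjoint A & B] ->
  wsign (A :|: B) C = wsign A C * wsign B C.
Proof.
move=> dAB; rewrite /wsign -bigU //=.
by apply: eq_bigl => i; rewrite !inE.
Qed.

Lemma wsignUr A B C : [disjoint B & C] ->
  wsign A (B :|: C) = wsign A B * wsign A C.
Proof.
move=> dBC; rewrite /wsign -big_split /=; apply: eq_bigr => i _.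
by rewrite -bigU //=; apply: eq_bigl => j; rewrite !inE.
Qed.

Lemma spinor_ind (P : spinor F n -> Prop) :
  (forall A, P (monomial A)) ->
  (forall a phi psi, P phi -> P psi -> P (a *: phi + psi)) ->
  forall phi, P phi.
Proof.
move=> Pm Pl phi; rewrite [phi]spinor_monomialE.
elim: (index_enum _) => [|A s IH]; last by rewrite big_cons; apply: Pl.
rewrite big_nil; have /= := Pl (-1) _ _ (Pm set0) (Pm set0).
by rewrite scaleN1r addNr.
Qed.

Lemma wedge_linearl chi a phi psi :
  wedge (a *: phi + psi) chi = a *: wedge phi chi + wedge psi chi.
Proof. exact: (wedgel_is_linear chi). Qed.

Lemma wedge_linearr chi a phi psi :
  wedge chi (a *: phi + psi) = a *: wedge chi phi + wedge chi psi.
Proof. exact: wedge_is_linear. Qed.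

Lemma wedgeZl a phi psi : wedge (a *: phi) psi = a *: wedge phi psi.
Proof. exact: (linearZZ (wedgel psi)). Qed.

Lemma wedgeZr a phi psi : wedge phi (a *: psi) = a *: wedge phi psi.
Proof. exact: (linearZZ (wedge phi)). Qed.

Lemma disjoint_setUl A B C :
  [disjoint A :|: B & C] = [disjoint A & C] && [disjoint B & C].
Proof. by rewrite -!setI_eq0 setIUl setU_eq0. Qed.

Lemma disjoint_setUr A B C :
  [disjoint A & B :|: C] = [disjoint A & B] && [disjoint A & C].
Proof. by rewrite -!setI_eq0 setIUr setU_eq0. Qed.

Lemma wedgeA : associative wedge.
Proof.
move=> phi psi chi; elim/spinor_ind: phi => [A|a p q Hp Hq]; last first.
  by rewrite !wedge_linearl Hp Hq.
elim/spinor_ind: psi => [B|a p q Hp Hq]; last first.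
  by rewrite !(wedge_linearl, wedge_linearr) Hp Hq.
elim/spinor_ind: chi => [C|a p q Hp Hq]; last first.
  by rewrite !wedge_linearr Hp Hq.
have mmE (D E : {set 'I_n}) : wedge (monomial D) (monomial E) =
    ([disjoint D & E]%:R * wsign D E) *: monomial (D :|: E).
  by rewrite wedge_monomial; case: ifP; rewrite ?mul1r ?mul0r ?scale0r.
rewrite !mmE wedgeZl linearZ /= !mmE !scalerA setUA; congr (_ *: _).
rewrite disjoint_setUl disjoint_setUr.
have [dAB|] := boolP [disjoint A & B]; last by rewrite !mul0r mulr0.
have [dBC|] := boolP [disjoint B & C]; last by rewrite /= andbF !mul0r mulr0.
have [dAC|] := boolP [disjoint A & C]; last by rewrite /= !mul0r !mulr0.
by rewrite /= wsignUl // wsignUr // !mul1r mulrC -mulrA.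
Qed.

Lemma wedge1m phi : wedge (monomial set0) phi = phi.
Proof.
elim/spinor_ind: phi => [A|a p q Hp Hq]; last by rewrite wedge_linearr Hp Hq.
by rewrite wedge_monomial -setI_eq0 set0I eqxx set0U /wsign big_set0 scale1r.
Qed.

Lemma wedgem1 phi : wedge phi (monomial set0) = phi.
Proof.
elim/spinor_ind: phi => [A|a p q Hp Hq]; last by rewrite wedge_linearl Hp Hq.
rewrite wedge_monomial -setI_eq0 setI0 eqxx setU0 /wsign big1 ?scale1r //.
by move=> i _; rewrite big_set0.
Qed.

HB.instance Definition _ := Monoid.isLaw.Build (spinor F n) (monomial set0)
  wedge wedgeA wedge1m wedgem1.

Lemma sorted_enum A : sorted (fun i j : 'I_n => i < j)%N (enum A).
Proof.
rewrite {1}/enum_mem; apply: sorted_filter; first by move=> x y z; apply: ltn_trans.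
by have := iota_ltn_sorted 0 n; rewrite -val_enum_ord sorted_map enumT.
Qed.

Lemma sorted_consP i (s : seq 'I_n) : sorted (fun i j : 'I_n => i < j)%N (i :: s) ->
  [/\ sorted (fun i j : 'I_n => i < j)%N s, i \notin s
    & wsign [set i] [set j in s] = 1].
Proof.
move=> Hs; have Hm := order_path_min (fun _ _ _ => @ltn_trans _ _ _) Hs.
split; first exact: path_sorted Hs.
  by apply/negP => si; have := allP Hm _ si; rewrite ltnn.
rewrite /wsign big_set1 big1 // => j.
by rewrite inE => /(allP Hm) /ltnW; rewrite leqNgt => /negPf->.
Qed.

Lemma setU1_in i (s : seq 'I_n) : i |: [set j in s] = [set j in i :: s].
Proof. by apply/setP=> x; rewrite !inE. Qed.

Lemma monomial_prod A :
  \big[wedge/monomial set0]_(i <- enum A) monomial [set i] = monomial A.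
Proof.
rewrite -{2}[A]set_enum; elim: (enum A) (sorted_enum A) => [|i s IH].
  by rewrite big_nil => _; congr monomial; apply/setP=> x; rewrite !inE.
move=> /sorted_consP[Hs si wis]; rewrite big_cons IH // wedge_monomial.
by rewrite disjoints1 inE si wis scale1r setU1_in.
Qed.

Lemma reverse_monomial A : reverse (monomial A) = wsign A A *: monomial A.
Proof.
rewrite /reverse (bigD1 A) //= [X in _ + X]big1 ?addr0; last first.
  by move=> B /negPf nBA; rewrite monomialE nBA scale0r.
rewrite monomialE eqxx scale1r -{2 3 4}[A]set_enum.
elim: (enum A) (sorted_enum A) => [|i s IH].
  rewrite big_nil => _; rewrite (_ : [set i in [::]] = set0); last first.
    by apply/setP=> x; rewrite !inE.
  by rewrite /wsign big_set0 scale1r.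
move=> /sorted_consP[Hs si wis]; rewrite rev_cons big_rcons /= IH // wedgeZl.
have dis : [disjoint [set i] & [set j in s]] by rewrite disjoints1 inE.
rewrite wedge_monomial disjoint_sym dis -!setU1_in setUC scalerA; congr (_ *: _).
rewrite wsignUl // !wsignUr // wis mulr1 [wsign [set i] _]big_set1 big_set1 ltnn.
by rewrite expr0 mul1r mulrC.
Qed.

Lemma reverse_linear a phi psi :
  reverse (a *: phi + psi) = a *: reverse phi + reverse psi.
Proof.
rewrite /reverse scaler_sumr -big_split /=; apply: eq_bigr => A _.
by rewrite !ffunE scalerDl scalerA.
Qed.

Lemma reverse0 : reverse 0 = 0.
Proof.
have := reverse_linear (-1) (monomial set0) (monomial set0).
by rewrite !scaleN1r !addNr.
Qed.

Lemma reverse_monomial1 (i : 'I_n) : reverse (monomial [set i]) = monomial [set i].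
Proof. by rewrite reverse_monomial /wsign !big_set1 ltnn scale1r. Qed.

Lemma wsign_sqr A B : wsign A B * wsign A B = 1.
Proof.
rewrite -big_split big1 //= => i _; rewrite -big_split big1 //= => j _.
by rewrite -expr2 sqrr_sign.
Qed.

Lemma reverse_wedge phi psi :
  reverse (wedge phi psi) = wedge (reverse psi) (reverse phi).
Proof.
elim/spinor_ind: phi => [A|a p q Hp Hq]; last first.
  by rewrite wedge_linearl !reverse_linear wedge_linearr Hp Hq.
elim/spinor_ind: psi => [B|a p q Hp Hq]; last first.
  by rewrite wedge_linearr !reverse_linear wedge_linearl Hp Hq.
rewrite !reverse_monomial wedgeZl linearZ /= !wedge_monomial disjoint_sym.
have reverseZ a chi : reverse (a *: chi) = a *: reverse chi.
  by have := reverse_linear a chi 0; rewrite reverse0 !addr0.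
have [dBA|_] := boolP [disjoint B & A]; last by rewrite reverse0 !scaler0.
have dAB : [disjoint A & B] by rewrite disjoint_sym.
rewrite reverseZ reverse_monomial setUC !scalerA; congr (_ *: _).
rewrite wsignUl // !wsignUr //.
by rewrite -[RHS]mulr1 -(wsign_sqr A B); ring.
Qed.

End ExteriorAlgebra.

Section Clifford.

Variables (F : fieldType) (V : vectType F) (n : nat) (e : n.-tuple V).
Implicit Types (x : V) (theta : covector V) (v w : (V * covector V)%type).
Implicit Types (phi psi : spinor F n) (I : {vspace V * covector V}).

(* Throughout, e is meant to be a basis of V, so that the linear forms
   coord e i = theta^i are the dual basis and
   theta = \sum_i theta (tnth e i) theta^i. *)
Definition form_of_covector theta : spinor F n :=
  \sum_(i < n) theta (tnth e i) *: monomial F [set i].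

(* Interior product by e_i: theta^(i |: A) = wsign [set i] A *: (theta^i /\ theta^A)
   for i \notin A, so theta^(i |: A) is sent to wsign [set i] A *: theta^A.
   By interior1 and interior_wedge, interior x is the antiderivation that
   extends theta |-> theta x. *)
Definition interior_basis (i : 'I_n) phi : spinor F n :=
  [ffun A : {set 'I_n} => if i \in A then 0 else wsign F [set i] A * phi (i |: A)].

Definition interior x phi : spinor F n :=
  \sum_(i < n) coord e i x *: interior_basis i phi.

Definition pairing v w : F := 2^-1 * (v.2 w.1 + w.2 v.1).

Definition clifford v phi : spinor F n :=
  interior v.1 phi + wedge (form_of_covector v.2) phi.

Definition isotropic I : Prop := forall v, v \in I -> pairing v v = 0.

(* The spinors annihilated by I; see LhatP. *)
Definition Lhat I : {vspace spinor F n} :=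
  (\bigcap_(v <- vbasis I) lker (linfun (clifford v)))%VS.

Lemma interior_basis_is_linear i : linear (interior_basis i).
Proof.
move=> a phi psi; apply/ffunP=> A; rewrite !ffunE; case: ifP => _.
  by rewrite scaler0 addr0.
by rewrite mulrDr; congr (_ + _); rewrite [LHS]mulrCA.
Qed.

HB.instance Definition _ i := GRing.isLinear.Build F (spinor F n) (spinor F n)
  *:%R (interior_basis i) (interior_basis_is_linear i).

Lemma clifford_is_linear v : linear (clifford v).
Proof.
move=> a phi psi; rewrite /clifford wedge_linearr /interior.
under eq_bigr do rewrite linearP scalerDr scalerA mulrC -scalerA.
by rewrite big_split /= -scaler_sumr scalerDr addrACA.
Qed.

HB.instance Definition _ v := GRing.isLinear.Build F (spinor F n) (spinor F n)
  *:%R (clifford v) (clifford_is_linear v).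

Lemma clifford_linearl a v w phi :
  clifford (a *: v + w) phi = a *: clifford v phi + clifford w phi.
Proof.
rewrite /clifford scalerDr addrACA; congr (_ + _).
  rewrite /interior scaler_sumr -big_split; apply: eq_bigr => i _ /=.
  by rewrite linearP scalerDl scalerA.
rewrite -wedge_linearl; congr wedge.
rewrite /form_of_covector scaler_sumr -big_split; apply: eq_bigr => i _ /=.
by rewrite !lfunE /= lfunE /= scalerDl scalerA.
Qed.

Lemma LhatP I phi :
  reflect (forall v, v \in I -> clifford v phi = 0) (phi \in Lhat I).
Proof.
have cap s : (phi \in \bigcap_(v <- s) lker (linfun (clifford v)))%VS =
    all (fun v => clifford v phi == 0) s.
  elim: s => [|v s IH]; first by rewrite big_nil memvf.
  by rewrite big_cons memv_cap IH memv_ker lfunE.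
rewrite /Lhat cap; apply: (iffP allP) => [H v vI|H v /vbasis_mem vI]; last first.
  exact/eqP/H.
rewrite (coord_vbasis vI).
have c0 : clifford 0 phi = 0.
  by have := clifford_linearl (-1) 0 0 phi; rewrite scaler0 addr0 scaleN1r addNr.
elim: (index_enum _) => [|i s IH]; first by rewrite big_nil.
rewrite big_cons clifford_linearl IH addr0.
by rewrite (eqP (H _ _)) ?scaler0 // mem_nth ?size_tuple.
Qed.

Lemma interior_basis_monomial i (A : {set 'I_n}) :
  interior_basis i (monomial F A) =
  if i \in A then wsign F [set i] (A :\ i) *: monomial F (A :\ i) else 0.
Proof.
apply/ffunP=> B; rewrite !ffunE.
have [iA|iA] := boolP (i \in A); last first.
  rewrite [RHS]ffunE; case: ifP => // iB.
  case: eqP => [E|]; last by rewrite mulr0.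
  by move: iA; rewrite -E setU11.
rewrite !ffunE; have [iB|iB] := boolP (i \in B).
  case: eqP => [E|]; last by rewrite scaler0.
  by move: iB; rewrite E setD11.
have -> : (i |: B == A) = (B == A :\ i).
  by apply/eqP/eqP => [<-|->]; rewrite ?setU1K ?setD1K.
by case: eqP => [->|] //; rewrite mulr0 scaler0.
Qed.

Lemma wsign1C (i j : 'I_n) : i != j ->
  wsign F [set i] [set j] = - wsign F [set j] [set i].
Proof.
rewrite /wsign !big_set1 neq_ltn => /orP[] lt; rewrite lt ltnNge ltnW //.
  by rewrite expr0 expr1 opprK.
Qed.

Lemma interior_basis_wedge i j phi :
  interior_basis i (wedge (monomial F [set j]) phi) =
  (i == j)%:R *: phi - wedge (monomial F [set j]) (interior_basis i phi).
Proof.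
elim/spinor_ind: phi => [A|a p q Hp Hq]; last first.
  rewrite wedge_linearr !linearP /= Hp Hq !linearP /=.
  by rewrite scalerA mulrC -scalerA addrACA.
rewrite interior_basis_monomial wedge_monomial disjoints1.
have sgn2 (B C : {set 'I_n}) (u : spinor F n) :
    wsign F B C *: (wsign F B C *: u) = u.
  by rewrite scalerA wsign_sqr scale1r.
have [<-|nij] := eqVneq i j.
  rewrite scale1r; have [iA|iA] /= := boolP (i \in A).
    rewrite linear0 wedgeZr wedge_monomial disjoints1 setD11 /= setD1K //.
    by rewrite sgn2 subrr.
  rewrite linearZ /= interior_basis_monomial setU11 setU1K //.
  by rewrite sgn2 linear0 subr0.
rewrite scale0r add0r; have [jA|jA] /= := boolP (j \in A).
  rewrite linear0; case: ifP => iA; last by rewrite linear0 oppr0.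
  rewrite wedgeZr wedge_monomial disjoints1 !inE eq_sym nij jA.
  by rewrite scaler0 oppr0.
rewrite linearZ /= interior_basis_monomial !inE (negPf nij) /=.
have [iA|iA] := boolP (i \in A); last by rewrite scaler0 linear0 oppr0.
rewrite wedgeZr wedge_monomial disjoints1 !inE eq_sym nij (negPf jA) /=.
have -> : (j |: A) :\ i = j |: (A :\ i).
  by apply/setP=> x; rewrite !inE; case: eqVneq => [->|//]; rewrite (negPf nij).
rewrite !scalerA -scaleNr; congr (_ *: _).
rewrite wsignUr; last by rewrite disjoints1 !inE (negPf jA) andbF.
rewrite wsign1C // -{1}(setD1K iA) wsignUr; last by rewrite disjoints1 setD11.
rewrite -[RHS]mulr1 -(wsign_sqr F [set j] [set i]).
by ring.
Qed.

Lemma interior_wedge x theta phi : basis_of fullv e ->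
  interior x (wedge (form_of_covector theta) phi) =
  theta x *: phi - wedge (form_of_covector theta) (interior x phi).
Proof.
move=> eV; have wsum (u : 'I_n -> spinor F n) c psi :
    wedge (\sum_j c j *: u j) psi = \sum_j c j *: wedge (u j) psi.
  rewrite -[LHS]/(wedgel psi _) linear_sum; apply: eq_bigr => j _.
  by rewrite linearZ.
rewrite /form_of_covector !wsum.
have -> : interior x (\sum_j theta (tnth e j) *: wedge (monomial F [set j]) phi) =
    \sum_j theta (tnth e j) *: (coord e j x *: phi
       - wedge (monomial F [set j]) (interior x phi)).
  rewrite /interior; under eq_bigr do rewrite linear_sum scaler_sumr.
  rewrite exchange_big; apply: eq_bigr => j _ /=.
  under eq_bigr do rewrite linearZ /= interior_basis_wedge scalerA mulrC -scalerA.
  rewrite -scaler_sumr; congr (_ *: _).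
  rewrite linear_sum; under eq_bigr do rewrite scalerBr; rewrite sumrB.
  congr (_ - _); last by apply: eq_bigr => i _; rewrite linearZ.
  rewrite (bigD1 j) //= eqxx scale1r big1 ?addr0 // => i /negPf->.
  by rewrite scale0r scaler0.
under eq_bigr do rewrite scalerBr; rewrite sumrB; congr (_ - _).
rewrite {2}(coord_basis eV (memvf x)) linear_sum scaler_suml.
apply: eq_bigr => j _; rewrite scalerA mulrC (tnth_nth 0).
by congr (_ *: _); rewrite linearZ.
Qed.

Lemma interior1 x : interior x (monomial F (set0 : {set 'I_n})) = 0.
Proof.
apply: big1 => i _; rewrite interior_basis_monomial in_set0; exact: scaler0.
Qed.

Lemma wedge_monomial1C (i j : 'I_n) : wedge (monomial F [set i]) (monomial F [set j]) =
  - wedge (monomial F [set j]) (monomial F [set i]).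
Proof.
rewrite !wedge_monomial !disjoints1 !inE eq_sym.
have [_|nij] := eqVneq j i; first by rewrite oppr0.
by rewrite /= wsign1C 1?eq_sym // setUC scaleNr.
Qed.

Lemma form_of_covector_sqr theta :
  wedge (form_of_covector theta) (form_of_covector theta) = 0.
Proof.
pose f (s : seq 'I_n) : spinor F n := \sum_(i <- s) theta (tnth e i) *: monomial F [set i].
have anti (j : 'I_n) s : wedge (f s) (monomial F [set j]) = - wedge (monomial F [set j]) (f s).
  rewrite /f; elim: s => [|i s IH].
    by rewrite !big_nil !linear0; apply: (linear0 (wedgel _)).
  rewrite big_cons wedge_linearl wedge_linearr IH opprD.
  by rewrite (wedge_monomial1C i j) scalerN.
rewrite /form_of_covector -/(f _); elim: (index_enum _) => [|i s IH].
  by rewrite /f big_nil linear0.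
have -> : f (i :: s) = theta (tnth e i) *: monomial F [set i] + f s by rewrite /f big_cons.
rewrite wedge_linearl !wedge_linearr IH anti addr0 scalerDr -addrA -scalerDr addrN.
by rewrite scaler0 addr0 wedge_monomial disjoints1 inE eqxx /= !scaler0.
Qed.

Lemma interior_linear x a phi psi :
  interior x (a *: phi + psi) = a *: interior x phi + interior x psi.
Proof.
rewrite /interior scaler_sumr -big_split; apply: eq_bigr => i _ /=.
by rewrite linearP scalerDr !scalerA mulrC.
Qed.

Lemma form_of_coord i : basis_of fullv e ->
  form_of_covector (linfun (coord e i : V -> F^o)) = monomial F [set i].
Proof.
move=> eV; rewrite /form_of_covector (bigD1 i) //= big1 ?addr0.
  by rewrite lfunE /= (tnth_nth 0) coord_free ?eqxx ?scale1r // (basis_free eV).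
move=> j /negPf nji; rewrite lfunE /= (tnth_nth 0).
by rewrite coord_free ?(basis_free eV) // nji scale0r.
Qed.

Lemma interiorK x phi : basis_of fullv e -> interior x (interior x phi) = 0.
Proof.
move=> eV; elim/spinor_ind: phi => [A|a p q Hp Hq]; last first.
  by rewrite !interior_linear Hp Hq scaler0 addr0.
have interior0 : interior x 0 = 0.
  by have := interior_linear x (-1) 0 0; rewrite scaler0 addr0 scaleN1r addNr.
have interiorN u : interior x (- u) = - interior x u.
  by have := interior_linear x (-1) u 0; rewrite interior0 !addr0 !scaleN1r.
rewrite -monomial_prod; elim: (enum A) => [|i s IH].
  by rewrite big_nil interior1 interior0.
rewrite big_cons -(form_of_coord i eV) interior_wedge //.
rewrite interior_linear interiorN interior_wedge // IH linear0 subr0.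
exact: addrN.
Qed.

Lemma cliffordK v phi : 2 != 0 :> F -> basis_of fullv e ->
  clifford v (clifford v phi) = pairing v v *: phi.
Proof.
move=> nz2 eV; rewrite /clifford linearD /= wedgeA form_of_covector_sqr.
have -> : wedge 0 phi = 0 by exact: (linear0 (wedgel phi)).
rewrite -[interior v.1 phi in X in X + _]scale1r interior_linear scale1r.
rewrite interiorK // interior_wedge // add0r addr0 subrK.
congr (_ *: _); apply: (mulfI nz2).
by rewrite mulrA divff // mul1r mulrDl !mul1r.
Qed.

End Clifford.

(* Main.v *)
(* For v in V + V^* we have v^2 = <v, v> and v w + w v = 2 <v, w> on spinors.  If
   J + <v> is isotropic and v is not in J, choose w orthogonal to J with
   <v, w> <> 0: then v and w both preserve Lhat J, and w makes the differential
   v exact there, so that Lhat (J + <v>) = ker v has half the dimension of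
   Lhat J.  Hence 2 ^ dim I * dim (Lhat I) = 2 ^ n.  A vector that annihilates
   Lhat I can be added to I without changing Lhat I, so by dimension it lies in
   I; the order and isotropy statements follow.  Clifford multiplication is
   self-adjoint for the bilinear form on spinors, and Lhat I lies in the image
   of any nonzero v in I, whence (7).  For (9), if I is not maximal then its
   orthogonal is not isotropic, and any w in it with <w, w> <> 0 exchanges the
   even and odd parts of Lhat I injectively. *)
Require Import Defs.
From mathcomp Require Import all_boot all_order all_algebra.
From mathcomp Require Import reals complex.
From mathcomp Require Import ring.
From HB Require Import structures.

Import GRing.Theory.
Local Open Scope ring_scope.

(** * The spinor form in coordinates and the adjoints of the generators *)

Section SpinorForm.
Set Implicit Arguments.
Unset Strict Implicit.

Variables (F : fieldType) (n : nat).
Implicit Types (i : 'I_n) (A B : {set 'I_n}) (phi psi chi : spinor F n).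

(** Reversal is diagonal in the monomial basis: [wsign F A A] has one factor -1 for each pair of
    indices in [A]. *)
Lemma reverseE phi A : reverse phi A = wsign F A A * phi A.
Proof.
elim/spinor_ind: phi => [B|a p q Hp Hq].
  rewrite reverse_monomial ffunE !monomialE -[LHS]/(_ * _).
  by case: eqP => [->|] //; rewrite !mulr0.
rewrite reverse_linear !ffunE Hp Hq mulrDr -[a *: _]/(a * _).
by rewrite mulrCA.
Qed.

Lemma wedge1E i phi A : wedge (monomial F [set i]) phi A =
  if i \in A then wsign F [set i] (A :\ i) * phi (A :\ i) else 0.
Proof.
rewrite ffunE; case: ifP => iA.
  rewrite (bigD1 [set i]) ?sub1set //= big1 ?addr0.
    by rewrite monomialE eqxx mul1r.
  by move=> B /andP[_ /negPf nB]; rewrite monomialE nB mul0r mulr0.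
apply: big1 => B sBA; rewrite monomialE; case: eqP => [E|_]; last first.
  by rewrite mul0r mulr0.
by move: sBA; rewrite E sub1set iA.
Qed.

Lemma spinor_formE phi psi : spinor_form phi psi =
  \sum_A wsign F A A * wsign F A (~: A) * (phi A * psi (~: A)).
Proof.
rewrite /spinor_form ffunE; under eq_bigl do rewrite subsetT.
by apply: eq_bigr => A _; rewrite setTD reverseE; ring.
Qed.

Lemma spinor_form_linearl a phi psi chi :
  spinor_form (a *: phi + psi) chi = a * spinor_form phi chi + spinor_form psi chi.
Proof. by rewrite /spinor_form reverse_linear wedge_linearl !ffunE. Qed.

Lemma spinor_form_linearr a phi psi chi :
  spinor_form chi (a *: phi + psi) = a * spinor_form chi phi + spinor_form chi psi.
Proof. by rewrite /spinor_form wedge_linearr !ffunE. Qed.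

Lemma spinor_form0l chi : spinor_form 0 chi = 0 :> F.
Proof.
by have := spinor_form_linearl (-1) 0 0 chi; rewrite scaler0 addr0 mulN1r addNr.
Qed.

Lemma spinor_form0r chi : spinor_form chi 0 = 0 :> F.
Proof. by rewrite /spinor_form linear0 ffunE. Qed.

Lemma spinor_form_wedge1 i phi psi :
  spinor_form (wedge (monomial F [set i]) phi) psi =
  spinor_form phi (wedge (monomial F [set i]) psi).
Proof. by rewrite /spinor_form reverse_wedge reverse_monomial1 wedgeA. Qed.

(** Both sides are signed sums of [phi A * psi (~: (A :\ i))] over the sets [A] containing [i], so
    only the signs have to be compared. *)
Lemma spinor_form_interior i phi psi :
  spinor_form (interior_basis i phi) psi = spinor_form phi (interior_basis i psi).
Proof.
rewrite !spinor_formE (bigID (fun A => i \in A)) /= big1 ?add0r; last first.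
  by move=> A iA; rewrite ffunE iA mul0r mulr0.
rewrite [RHS](bigID (fun A => i \in A)) /= [X in _ = _ + X]big1 ?addr0; last first.
  by move=> A iA; rewrite [interior_basis i psi _]ffunE inE iA !mulr0.
rewrite (reindex_onto (fun A => A :\ i) (fun A => i |: A)) /=; last first.
  by move=> A iA; rewrite setU1K.
apply: eq_big => [A|A].
  rewrite setD11 /=; apply/eqP/idP => [<-|iA]; first exact: setU11.
  exact: setD1K.
rewrite setD11 /= => /eqP E; have iA : i \in A by rewrite -E setU11.
rewrite !ffunE setD11 inE iA /= E.
have cA : i |: ~: A = ~: (A :\ i).
  by apply/setP => x; rewrite !inE; case: eqVneq.
rewrite cA; move: (A :\ i) (setD11 i A) E cA => B iB <- <-.
have dB : [disjoint [set i] & B] by rewrite disjoints1 iB.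
rewrite !wsignUl // !(wsignUr _ _ dB) wsignUr; last by rewrite disjoints1 !inE eqxx.
have -> : wsign F [set i] [set i] = 1 by rewrite /wsign !big_set1 ltnn.
(* The two signs differ by the square of [wsign F [set i] C], which is 1. *)
rewrite !mul1r; set C := ~: _; rewrite -[LHS]mulr1 -(wsign_sqr F [set i] C); ring.
Qed.

(** * Projections onto even and odd forms *)

(** The Boolean index treats both chiralities at once: [false] stands for $S^+$ and [true] for
    $S^-$. *)
Definition parity_part (b : bool) phi : spinor F n :=
  [ffun A : {set 'I_n} => if odd #|A| == b then phi A else 0].

Lemma parity_part_is_linear b : linear (parity_part b).
Proof.
move=> a phi psi; apply/ffunP=> A; rewrite !ffunE; case: ifP => // _.
by rewrite scaler0 addr0.
Qed.

HB.instance Definition _ b := GRing.isLinear.Build F (spinor F n) (spinor F n)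
  *:%R (parity_part b) (parity_part_is_linear b).

Lemma parity_partD phi : parity_part false phi + parity_part true phi = phi.
Proof. by apply/ffunP=> A; rewrite !ffunE; case: odd; rewrite ?addr0 ?add0r. Qed.

Lemma parity_part_id b phi : parity_part b (parity_part b phi) = parity_part b phi.
Proof. by apply/ffunP=> A; rewrite !ffunE; case: eqP. Qed.

Lemma parity_part_neq b c phi : b != c -> parity_part b (parity_part c phi) = 0.
Proof.
move=> bc; apply/ffunP=> A; rewrite !ffunE; case: eqP => // ->.
by rewrite (negPf bc).
Qed.

Lemma span_parityP b phi :
  reflect (parity_part b phi = phi)
    (phi \in <<[seq monomial F A | A in [set A : {set 'I_n} | odd #|A| == b]]>>%VS).
Proof.
apply: (iffP idP) => [/coord_span ->|<-].
  rewrite linear_sum; apply: eq_bigr => j _; rewrite linearZ /=; congr (_ *: _).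
  set s := [seq _ | _ in _]; have : s`_j \in s by rewrite mem_nth // size_image.
  move=> /mapP[A]; rewrite mem_enum inE => /eqP oA ->.
  apply/ffunP=> B; rewrite !ffunE; case: (eqVneq B A) => [->|_]; first by rewrite oA eqxx.
  by rewrite if_same.
rewrite [parity_part b phi]spinor_monomialE; apply: memv_suml => A _.
rewrite ffunE; case: eqP => [oA|_]; last by rewrite scale0r mem0v.
by apply/memvZ/memv_span/map_f; rewrite mem_enum inE oA eqxx.
Qed.

Lemma weyl_posP phi : reflect (parity_part false phi = phi) (phi \in weyl_pos F n).
Proof.
rewrite /weyl_pos; have -> : [set A : {set 'I_n} | ~~ odd #|A|] =
  [set A : {set 'I_n} | odd #|A| == false] by apply/setP=> A; rewrite !inE eqbF_neg.
exact: span_parityP.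
Qed.

Lemma weyl_negP phi : reflect (parity_part true phi = phi) (phi \in weyl_neg F n).
Proof.
rewrite /weyl_neg; have -> : [set A : {set 'I_n} | odd #|A|] =
  [set A : {set 'I_n} | odd #|A| == true] by apply/setP=> A; rewrite !inE eqb_id.
exact: span_parityP.
Qed.

End SpinorForm.

(** * Linear functionals that separate a vector from a subspace *)

Section Functionals.
Set Implicit Arguments.
Unset Strict Implicit.

Variable F : fieldType.

Lemma linear_lfun (U W : vectType F) (g : U -> W) :
  linear g -> exists h : 'Hom(U, W), h =1 g.
Proof.
move=> lg; pose g' : {linear U -> W} :=
  HB.pack g (GRing.isLinear.Build F U W *:%R g lg).
by exists (linfun g') => x; rewrite lfunE.
Qed.

(** The projection along [J] onto a complement kills [J] but not [v]; some coordinate of the image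
    of [v] is then nonzero. *)
Lemma separating_functional (W : vectType F) (J : {vspace W}) (v : W) :
  v \notin J -> exists f : 'Hom(W, F^o),
    (forall u, u \in J -> f u = 0) /\ f v != 0.
Proof.
move=> vJ; pose p := daddv_pi J^C J.
have CJ : (J^C :&: J = 0)%VS by rewrite capvC capv_compl.
have p0 u : u \in J -> p u = 0.
  move=> uJ; apply: (addIr (daddv_pi J J^C u)).
  rewrite daddv_pi_add ?addv_complf ?memvf //; last by rewrite addvC addv_complf memvf.
  by rewrite add0r daddv_pi_id // capv_compl.
have pv : p v != 0.
  apply: contra vJ => /eqP pv0.
  rewrite -[v](daddv_pi_add CJ); last by rewrite addvC addv_complf memvf.
  by rewrite -/p pv0 add0r memv_pi.
have [i ci] : exists i, coord (vbasis {:W}) i (p v) != 0.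
  apply/existsP; apply: contraR pv; rewrite negb_exists => /forallP c0.
  rewrite (coord_vbasis (memvf (p v))) big1 // => i _.
  by have := c0 i; rewrite negbK => /eqP->; rewrite scale0r.
exists (linfun (coord (vbasis {:W}) i : W -> F^o) \o p)%VF;
  split=> [u uJ|]; rewrite comp_lfunE lfunE.
  by rewrite p0 // linear0.
exact: ci.
Qed.

End Functionals.

(** * Parity and adjointness of Clifford multiplication *)

Section CliffordTheory.
Set Implicit Arguments.
Unset Strict Implicit.

Variables (F : fieldType) (V : vectType F) (n : nat) (e : n.-tuple V).
Implicit Types (v w : (V * covector V)%type) (phi psi : spinor F n).
Implicit Types (I J : {vspace V * covector V}).

(** Reduces identities for Clifford multiplication to the generators, contraction with $e_i$ and
    exterior multiplication by $\theta^i$. *)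
Lemma clifford_sum v phi : clifford e v phi =
  \sum_i (coord e i v.1 *: interior_basis i phi
          + v.2 (tnth e i) *: wedge (monomial F [set i]) phi).
Proof.
rewrite big_split /=; congr (_ + _); rewrite /form_of_covector.
rewrite -[LHS]/(wedgel phi _) linear_sum; apply: eq_bigr => i _.
by rewrite linearZ.
Qed.

Lemma odd_cardD1 (i : 'I_n) (A : {set 'I_n}) : i \in A -> odd #|A :\ i| = ~~ odd #|A|.
Proof. by move=> iA; rewrite [in RHS](cardsD1 i) iA oddD negbK. Qed.

(** Each generator changes the degree of a monomial by one. *)
Lemma clifford_parity_part b v phi :
  clifford e v (parity_part b phi) = parity_part (~~ b) (clifford e v phi).
Proof.
rewrite !clifford_sum linear_sum; apply: eq_bigr => i _ /=.
rewrite linearD !linearZ /=; congr (_ *: _ + _ *: _); apply/ffunP=> A.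
  rewrite !ffunE; have [iA|iA] := boolP (i \in A); first by rewrite if_same.
  by rewrite cardsU1 iA /=; case: (odd _) b => [] [] /=; rewrite ?mulr0.
rewrite wedge1E [RHS]ffunE wedge1E ffunE.
have [iA|iA] := boolP (i \in A); last by rewrite if_same.
by rewrite odd_cardD1 //; case: (odd _) b => [] [] /=; rewrite ?mulr0.
Qed.

Lemma spinor_form_clifford v phi psi :
  spinor_form (clifford e v phi) psi = spinor_form phi (clifford e v psi).
Proof.
rewrite !clifford_sum; elim: (index_enum _) => [|i s IH].
  by rewrite !big_nil spinor_form0l spinor_form0r.
rewrite !big_cons -!addrA !(spinor_form_linearl, spinor_form_linearr) IH.
by rewrite spinor_form_interior spinor_form_wedge1.
Qed.

(** * Bilinearity of the pairing and the Clifford relations *)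

Lemma pairingC v w : pairing v w = pairing w v.
Proof. by rewrite /pairing addrC. Qed.

Lemma pairing_linearl a u v w :
  pairing (a *: u + v) w = a * pairing u w + pairing v w.
Proof.
rewrite /pairing /= linearP lfunE /= lfunE /= -[a *: u.2 _]/(a * _).
rewrite -[a *: w.2 _]/(a * _); ring.
Qed.

Lemma pairingDl u v w : pairing (u + v) w = pairing u w + pairing v w.
Proof. by have := pairing_linearl 1 u v w; rewrite scale1r mul1r. Qed.

Lemma pairing0l w : pairing 0 w = 0.
Proof. by have := pairing_linearl (-1) 0 0 w; rewrite scaler0 addr0 mulN1r addNr. Qed.

Lemma pairingDr u v w : pairing w (u + v) = pairing w u + pairing w v.
Proof. by rewrite pairingC pairingDl !(pairingC w). Qed.

Hypotheses (nz2 : 2 != 0 :> F) (eV : basis_of {:V} e).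

Lemma pairing_sqrD v w : pairing (v + w) (v + w) =
  pairing v v + pairing w w + 2 * pairing v w.
Proof. by rewrite pairingDl !pairingDr (pairingC w v); ring. Qed.

Lemma isotropic_pairing0 I : isotropic I ->
  forall v w, v \in I -> w \in I -> pairing v w = 0.
Proof.
move=> iI v w vI wI; have := iI _ (memvD vI wI).
rewrite pairing_sqrD !iI // !add0r => /eqP.
by rewrite mulf_eq0 (negPf nz2) => /eqP.
Qed.

Lemma isotropic_subv I J : (I <= J)%VS -> isotropic J -> isotropic I.
Proof. by move=> /subvP sIJ iJ v /sIJ/iJ. Qed.

Lemma cliffordDl v w phi : clifford e (v + w) phi = clifford e v phi + clifford e w phi.
Proof. by have := clifford_linearl e 1 v w phi; rewrite !scale1r. Qed.

Lemma cliffordDr v phi psi : clifford e v (phi + psi) = clifford e v phi + clifford e v psi.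
Proof. exact: linearD. Qed.

Lemma cliffordZl a v phi : clifford e (a *: v) phi = a *: clifford e v phi.
Proof.
have c0 : clifford e 0 phi = 0.
  by apply: (addrI (clifford e 0 phi)); rewrite -cliffordDl !addr0.
by have := clifford_linearl e a v 0 phi; rewrite c0 !addr0.
Qed.

(** Polarization of [cliffordK]: expand the square of [v + w] and cancel the squares of [v] and
    [w]. *)
Lemma clifford_anticomm v w phi :
  clifford e v (clifford e w phi) + clifford e w (clifford e v phi) =
  (2 * pairing v w) *: phi.
Proof.
have cancel (a b c d x : spinor F n) : a + d + (c + b) = a + b + x -> d + c = x.
  by rewrite [c + b]addrC addrACA => /addrI.
have := cliffordK (v + w) phi nz2 eV.
rewrite pairing_sqrD !scalerDl -!(cliffordK _ _ nz2 eV) !cliffordDl.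
rewrite !(cliffordDr _ (clifford e _ phi)); exact: cancel.
Qed.

(** * Nondegeneracy of the pairing *)

Lemma pairing_representation (f : 'Hom((V * covector V)%type, F^o)) :
  exists w, forall v, f v = pairing v w.
Proof.
pose eps i : covector V := linfun (coord e i : V -> F^o).
have [h hE] : exists h : covector V, h =1 (fun x => 2 *: f (x, 0)).
  apply: linear_lfun => a x y.
  have -> : (a *: x + y, 0) = a *: (x, 0) + (y, 0) :> V * covector V.
    by congr pair; rewrite /= scaler0 addr0.
  by rewrite linearP scalerDr !scalerA mulrC.
(* The restriction of [f] to $V$ gives the covector part of [w], and its values on the dual basis
   give the coordinates of the vector part; the factors 2 cancel the [2^-1] in [pairing]. *)
exists (\sum_i (2 * f (0, eps i)) *: tnth e i, h) => v.
have v2E : v.2 = \sum_i v.2 (tnth e i) *: eps i.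
  apply/lfunP => x; rewrite {1}(coord_basis eV (memvf x)) linear_sum sum_lfunE.
  apply: eq_bigr => i _; rewrite linearZ !lfunE /= (tnth_nth 0).
  by rewrite lfunE /= -[LHS]/(_ * _) mulrC.
have fv2 (c : 'I_n -> F) : f (0, \sum_i c i *: eps i) = \sum_i c i * f (0, eps i).
  elim: (index_enum _) => [|i s IH]; first by rewrite !big_nil linear0.
  rewrite !big_cons -IH.
  have -> u : (0, c i *: eps i + u) = c i *: (0, eps i) + (0, u) :> V * covector V.
    by congr pair; rewrite /= scaler0 addr0.
  by rewrite linearP.
have -> : f v = f (v.1, 0) + f (0, v.2).
  rewrite -linearD; congr (f _).
  by case: v {v2E} => x y; congr pair; rewrite /= ?addr0 ?add0r.
rewrite v2E fv2 /pairing /= hE linear_sum mulrDr.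
rewrite -[2 *: _]/(2 * _) mulrA mulVf // mul1r addrC; congr (_ + _).
rewrite mulr_sumr; apply: eq_bigr => i _; rewrite linearZ -[X in _ = _ * X]/(_ * _).
by rewrite !mulrA mulVf // mul1r mulrC.
Qed.

Lemma separating_vector J v : v \notin J ->
  exists w, (forall u, u \in J -> pairing u w = 0) /\ pairing v w != 0.
Proof.
move=> /separating_functional[f [fJ fv]].
have [w fE] := pairing_representation f.
by exists w; split=> [u /fJ|]; rewrite -fE.
Qed.

(** * Annihilated spinors and their dimension *)

(** A vector orthogonal to [J] anticommutes with every element of [J]. *)
Lemma clifford_Lhat J w : (forall u, u \in J -> pairing u w = 0) ->
  forall phi, phi \in Lhat e J -> clifford e w phi \in Lhat e J.
Proof.
move=> Jw phi /LhatP phiJ; apply/LhatP => u uJ.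
have := clifford_anticomm u w phi.
by rewrite (phiJ u uJ) linear0 addr0 Jw // mulr0 scale0r.
Qed.

Lemma Lhat_add I J : Lhat e (I + J)%VS = (Lhat e I :&: Lhat e J)%VS.
Proof.
apply/vspaceP=> phi; rewrite memv_cap; apply/LhatP/andP => [H|[/LhatP HI /LhatP HJ]].
  by split; apply/LhatP => v vI; apply: H; apply: (subvP _ v vI); rewrite ?addvSl ?addvSr.
by move=> _ /memv_addP[u uI [w wJ ->]]; rewrite cliffordDl HI // HJ // addr0.
Qed.

Lemma Lhat_line v : Lhat e <[v]>%VS = lker (linfun (clifford e v)).
Proof.
apply/vspaceP=> phi; rewrite memv_ker lfunE; apply/LhatP/eqP => [H|H _ /vlineP[a ->]].
  exact/H/memv_line.
by rewrite cliffordZl H scaler0.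
Qed.

Lemma Lhat_subv I J : (I <= J)%VS -> (Lhat e J <= Lhat e I)%VS.
Proof.
by move=> /subvP sIJ; apply/subvP=> phi /LhatP H; apply/LhatP=> v /sIJ/H.
Qed.

Lemma dim_Lhat_add_line J v : v \notin J -> isotropic (<[v]> + J)%VS ->
  \dim (Lhat e J) = (2 * \dim (Lhat e (<[v]> + J)%VS))%N.
Proof.
move=> vJ iJ; have [w [Jw vw]] := separating_vector vJ.
have vv : pairing v v = 0 by apply: iJ; apply: (subvP (addvSl _ _)); apply: memv_line.
have Jv u : u \in J -> pairing u v = 0.
  move=> uJ; apply: (isotropic_pairing0 iJ).
    exact: (subvP (addvSr _ _)).
  by apply: (subvP (addvSl _ _)); apply: memv_line.
rewrite Lhat_add Lhat_line capvC -(limg_ker_dim (linfun (clifford e v)) (Lhat e J)).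
(* Once image and kernel of [v] on [Lhat e J] agree, rank-nullity gives the factor 2. *)
set K := (_ :&: _)%VS; suff -> : (linfun (clifford e v) @: Lhat e J)%VS = K.
  by rewrite mul2n addnn.
apply/vspaceP=> phi; rewrite memv_cap memv_ker lfunE /=.
apply/memv_imgP/andP => [[psi psiJ ->]|[phiJ /eqP vphi]].
  by rewrite lfunE /= clifford_Lhat // cliffordK // vv scale0r.
have nz : 2 * pairing v w != 0 by rewrite mulf_neq0.
(* On the kernel of [v] the anticommutator reduces to [v] applied to [w phi], so dividing by
   [2 * pairing v w] yields a preimage. *)
exists ((2 * pairing v w)^-1 *: clifford e w phi).
  by apply/memvZ/clifford_Lhat.
rewrite lfunE /= linearZ /=; have := clifford_anticomm v w phi.
by rewrite vphi linear0 addr0 => ->; rewrite scalerA mulVf // scale1r.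
Qed.

Lemma dim_spinor : \dim {:spinor F n} = (2 ^ n)%N.
Proof. by rewrite dimvf /dim /= muln1 -cardsT -powersetT card_powerset cardsT card_ord. Qed.

(** The product form avoids truncated subtraction, and by divisibility it also bounds [\dim I] by
    [n]. *)
Lemma exp_dim_Lhat I : isotropic I -> (2 ^ \dim I * \dim (Lhat e I))%N = (2 ^ n)%N.
Proof.
rewrite -dim_spinor.
(* Induction on a free list: each new vector lies outside the span of the tail, so it halves the
   dimension. *)
suff free_case (s : seq (V * covector V)) : free s -> isotropic <<s>>%VS ->
    (2 ^ size s * \dim (Lhat e <<s>>))%N = \dim {:spinor F n}.
  have := free_case (vbasis I); rewrite size_tuple (span_basis (vbasisP I)).
  by apply; apply: basis_free (vbasisP I).
elim: s => [_ _|v s IH].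
  rewrite span_nil mul1n; congr (\dim _); apply/vspaceP=> phi.
  rewrite memvf; apply/LhatP => v; rewrite memv0 => /eqP->.
  by have := cliffordZl 0 0 phi; rewrite !scale0r.
rewrite free_cons span_cons => /andP[vs fs] iJ.
rewrite expnSr -mulnA -dim_Lhat_add_line // IH //.
exact: isotropic_subv (addvSr _ _) iJ.
Qed.

Lemma isotropic_dim_le I : isotropic I -> (\dim I <= n)%N.
Proof.
by move=> /exp_dim_Lhat E; rewrite -(leq_exp2l (m := 2)) // dvdn_leq ?expn_gt0 // -E dvdn_mulr.
Qed.

Lemma dim_Lhat I : isotropic I -> \dim (Lhat e I) = (2 ^ (n - \dim I))%N.
Proof.
move=> iI; rewrite expnB ?isotropic_dim_le // -(exp_dim_Lhat iI).
by rewrite mulKn // expn_gt0.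
Qed.

(** * Consequences for isotropy, inclusion and the spinor form *)

Lemma Lhat_neq0 I : isotropic I -> Lhat e I != 0%VS.
Proof. by move=> iI; rewrite -dimv_eq0 dim_Lhat // -lt0n expn_gt0. Qed.

(** The square of [v] acts as the scalar [pairing v v], which must vanish if [v] kills a nonzero
    spinor. *)
Lemma isotropic_common_kernel I phi : phi != 0 -> phi \in Lhat e I -> isotropic I.
Proof.
move=> nz /LhatP H v vI; apply/eqP; have := cliffordK v phi nz2 eV.
by rewrite !H // linear0 => /esym/eqP; rewrite scaler_eq0 (negPf nz) orbF.
Qed.

Lemma isotropic_addP I J :
  isotropic (I + J)%VS <-> (Lhat e I :&: Lhat e J)%VS <> 0%VS.
Proof.
rewrite -Lhat_add; split=> [/Lhat_neq0/eqP //|/eqP nz].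
have nzv : vpick (Lhat e (I + J)) != 0 by rewrite vpick0.
exact: isotropic_common_kernel nzv (memv_pick _).
Qed.

Lemma Lhat_annihilator I u : isotropic I ->
  (forall phi, phi \in Lhat e I -> clifford e u phi = 0) -> u \in I.
Proof.
move=> iI uI; have EL : Lhat e (<[u]> + I)%VS = Lhat e I.
  rewrite Lhat_add Lhat_line; apply/capv_idPr/subvP => phi /uI u0.
  by rewrite memv_ker lfunE /= u0.
have iJ : isotropic (<[u]> + I)%VS.
  by apply/isotropic_addP; rewrite -Lhat_add EL; apply/eqP/Lhat_neq0.
(* If [u] were outside [I], adding it would halve the dimension; but [Lhat e I] is unchanged and its
   dimension is a power of 2, hence nonzero. *)
apply: contraT => uJ; have := dim_Lhat_add_line uJ iJ.
by rewrite EL dim_Lhat // => /eqP; rewrite mul2n -addnn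
  -{1}[(2 ^ _)%N]addn0 eqn_add2l eq_sym expn_eq0.
Qed.

Lemma Lhat_subvE I J : isotropic I -> (J <= I)%VS = (Lhat e I <= Lhat e J)%VS.
Proof.
move=> iI; apply/idP/idP => [|/subvP sL]; first exact: Lhat_subv.
apply/subvP => u uJ; apply: Lhat_annihilator iI _ => phi /sL /LhatP; exact.
Qed.

Lemma spinor_form_Lhat I phi psi : isotropic I -> I != 0%VS ->
  phi \in Lhat e I -> psi \in Lhat e I -> spinor_form phi psi = 0.
Proof.
move=> iI nz /LhatP phiI /LhatP psiI; pose v := vpick I.
have vI : v \in I := memv_pick I.
have [w [_ vw]] : exists w, (forall u, u \in 0%VS -> pairing u w = 0) /\ pairing v w != 0.
  by apply: separating_vector; rewrite memv0 vpick0.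
have nz' : 2 * pairing v w != 0 by rewrite mulf_neq0.
(* Since [v] kills [phi], the anticommutator with [w] exhibits [phi] as an image under [v]; by
   adjointness [v] then moves over to [psi], which it kills. *)
have phiE : phi = clifford e v ((2 * pairing v w)^-1 *: clifford e w phi).
  rewrite linearZ /=; have := clifford_anticomm v w phi.
  by rewrite (phiI v vI) linear0 addr0 => ->; rewrite scalerA mulVf // scale1r.
by rewrite phiE spinor_form_clifford psiI // spinor_form0r.
Qed.

(** * Orthogonal complements and the chirality decomposition *)

(** Rank-nullity for the map that pairs a vector with a basis of [I]: its rank is at most
    [\dim I]. *)
Lemma orthogonal_complement I : exists K : {vspace V * covector V},
  (n + n <= \dim K + \dim I)%N /\
  forall u w, u \in I -> w \in K -> pairing u w = 0.
Proof.
have [h hE] : exists h : 'Hom((V * covector V)%type, 'rV[F]_(\dim I)),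
    h =1 (fun w => \row_j pairing (vbasis I)`_j w).
  apply: linear_lfun => a x y; apply/rowP=> j.
  by rewrite !mxE pairingC pairing_linearl !(pairingC _ _`_j).
exists (lker h); split=> [|u w uI].
  have dimW : \dim {: (V * covector V)%type} = (n + n)%N.
    have dimV : dim V = n by rewrite -dimvf (size_basis eV).
    by rewrite dimvf; exact: (congr2 addn dimV (etrans (muln1 _) dimV)).
  rewrite -dimW -(limg_ker_dim h fullv) capfv leq_add2l.
  by rewrite (leq_trans (dimvS (subvf _))) // dimvf /dim /= mul1n.
rewrite memv_ker hE => /eqP/rowP h0; rewrite (coord_vbasis uI).
elim: (index_enum _) => [|j s IH]; first by rewrite big_nil pairing0l.
rewrite big_cons pairing_linearl IH addr0.
by have := h0 j; rewrite !mxE => ->; rewrite mulr0.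
Qed.

Lemma Lhat_parity_part b I phi : phi \in Lhat e I -> parity_part b phi \in Lhat e I.
Proof.
move=> /LhatP H; apply/LhatP => v vI.
by rewrite clifford_parity_part H // linear0.
Qed.

(** As the kernel of the opposite projection, either parity is available as a subspace without
    reference to spanning monomials. *)
Definition parity_space b : {vspace spinor F n} := lker (linfun (parity_part (~~ b))).

Lemma mem_parity_space b phi : (phi \in parity_space b) = (parity_part b phi == phi).
Proof.
rewrite memv_ker lfunE /=.
have -> : parity_part (~~ b) phi = phi - parity_part b phi.
  by rewrite -{2}(parity_partD phi); case: b; rewrite ?addrK // addrC addKr.
by rewrite subr_eq0 eq_sym.
Qed.

Lemma weyl_posE : weyl_pos F n = parity_space false.
Proof. by apply/vspaceP=> phi; rewrite mem_parity_space; apply/weyl_posP/eqP. Qed.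

Lemma weyl_negE : weyl_neg F n = parity_space true.
Proof. by apply/vspaceP=> phi; rewrite mem_parity_space; apply/weyl_negP/eqP. Qed.

Lemma Lhat_parityD I : Lhat e I =
  (Lhat e I :&: parity_space false + Lhat e I :&: parity_space true)%VS.
Proof.
apply/eqP; rewrite eqEsubv subv_add !capvSl !andbT; apply/subvP=> phi phiI.
rewrite -(parity_partD phi); apply: memv_add;
  by rewrite memv_cap Lhat_parity_part // mem_parity_space parity_part_id eqxx.
Qed.

Lemma parity_space_direct : (parity_space false :&: parity_space true)%VS = 0%VS.
Proof.
apply/eqP; rewrite -subv0; apply/subvP=> phi.
rewrite memv_cap !mem_parity_space => /andP[/eqP <- /eqP <-].
by rewrite parity_part_neq // mem0v.
Qed.

(** Multiplication by [w] preserves [Lhat e I] and reverses parity; it is injective because its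
    square is a nonzero scalar. *)
Lemma leq_dim_Lhat_parity b I w : (forall u, u \in I -> pairing u w = 0) ->
  pairing w w != 0 ->
  (\dim (Lhat e I :&: parity_space b) <= \dim (Lhat e I :&: parity_space (~~ b)))%N.
Proof.
move=> Iw nz; set L := (_ :&: parity_space b)%VS.
rewrite -(limg_dim_eq (f := linfun (clifford e w)) (U := L)); last first.
  apply/eqP; rewrite -subv0; apply/subvP=> phi.
  rewrite memv_cap memv_ker lfunE /= memv0 => /andP[_ /eqP w0].
  have := cliffordK w phi nz2 eV; rewrite w0 linear0 => /esym/eqP.
  by rewrite scaler_eq0 (negPf nz).
apply/dimvS/subvP => _ /memv_imgP[phi + ->].
rewrite !memv_cap lfunE /= !mem_parity_space => /andP[phiI /eqP <-].
by rewrite clifford_Lhat ?Lhat_parity_part // clifford_parity_part parity_part_id eqxx.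
Qed.

Lemma dim_Lhat_parity I : isotropic I -> \dim I != n ->
  \dim (Lhat e I :&: parity_space false) = \dim (Lhat e I :&: parity_space true).
Proof.
move=> iI dI; apply/eqP/contraT => neq.
have [K [dK IK]] := orthogonal_complement I.
(* A vector of [K] with nonzero square would give both inequalities between the two dimensions,
   contradicting [neq]. *)
have iK : isotropic K.
  move=> w wK; apply/eqP; apply: contraR neq => nz.
  by rewrite eqn_leq !(@leq_dim_Lhat_parity _ I w) // => u uI; apply: IK.
have ltI : (\dim I < n)%N by rewrite ltn_neqAle dI isotropic_dim_le.
(* Isotropy of [K] bounds its dimension by [n], which forces [n <= \dim I]. *)
have := leq_trans dK (leq_add (isotropic_dim_le iK) (leqnn (\dim I))).
by rewrite leq_add2l leqNgt ltI.
Qed.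

End CliffordTheory.

(** * Assembly of the nine claims over the complex numbers *)

Theorem theorem1 (R : realType) (V : vectType R[i]) (n : nat) (hn : (1 <= n)%N)
    (hV : \dim {:V} = n) (e : n.-tuple V) (he : basis_of {:V} e)
    (I I' : {vspace V * covector V})
    (hI : isotropic I) (hI' : isotropic I') :
  (\dim (Lhat e I) = 2 ^ (n - \dim I))%N /\
  (Lhat e I = Lhat e I' <-> I = I') /\
  (Lhat e I + Lhat e I' <= Lhat e (I :&: I'))%VS /\
  (isotropic (I + I')%VS ->
    Lhat e (I + I')%VS = (Lhat e I :&: Lhat e I')%VS) /\
  (forall u : V * covector V,
    (forall phi, phi \in Lhat e I -> clifford e u phi = 0) -> u \in I) /\
  ((I' <= I)%VS <-> (Lhat e I <= Lhat e I')%VS) /\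
  (I <> 0%VS -> forall phi psi, phi \in Lhat e I -> psi \in Lhat e I ->
    spinor_form phi psi = 0) /\
  (isotropic (I + I')%VS <-> (Lhat e I :&: Lhat e I')%VS <> 0%VS) /\
  (\dim I <> n ->
    exists Lpos Lneg : {vspace spinor R[i] n},
      [/\ (Lpos <= weyl_pos R[i] n)%VS, (Lneg <= weyl_neg R[i] n)%VS,
          Lhat e I = (Lpos + Lneg)%VS, directv (Lpos + Lneg)
        & \dim Lpos = \dim Lneg]).
Proof.
have nz2 : 2 != 0 :> R[i] by rewrite Num.Theory.pnatr_eq0.
split; first exact: dim_Lhat.
split.
  split=> [EL|-> //]; apply/eqP.
  by rewrite eqEsubv (Lhat_subvE nz2 he _ hI) (Lhat_subvE nz2 he _ hI') EL subvv.
split; first by rewrite subv_add !Lhat_subv ?capvSl ?capvSr.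
split; first by move=> _; exact: Lhat_add.
split; first by move=> u; exact: Lhat_annihilator.
split; first by rewrite (Lhat_subvE nz2 he _ hI).
split; first by move=> /eqP nz phi psi; exact: spinor_form_Lhat.
split; first exact: isotropic_addP.
move=> /eqP dI; exists (Lhat e I :&: parity_space R[i] n false)%VS.
exists (Lhat e I :&: parity_space R[i] n true)%VS.
split.
- by rewrite weyl_posE capvSr.
- by rewrite weyl_negE capvSr.
- exact: Lhat_parityD.
(* Directness is inherited from the even and odd subspaces, which meet only in 0. *)
- apply/directv_addP/eqP; rewrite -subv0 -(parity_space_direct R[i] n).
  by rewrite capvS ?capvSr.
- exact: dim_Lhat_parity.
Qed.
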